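(* Let $A$ be a commutative ring and $\sigma$ a finite type hereditary torsion theory in the category of $A$-modules. The following statements are equivalent: (a) $A$ is totally $\sigma$-noetherian. (b) Every prime ideal in $\mathcal{K}(\sigma)$ is totally $\sigma$-finitely generated.
   Context: Rings are commutative with unit. A hereditary torsion theory $\sigma$ in the category of $A$-modules is given by its Gabriel filter $\mathcal{L}(\sigma)$: a non-empty filter of ideals of $A$ such that every ideal $\mathfrak{b}\subseteq A$ for which there exists $\mathfrak{a}\in\mathcal{L}(\sigma)$ with $(\mathfrak{b}:a)\in\mathcal{L}(\sigma)$ for every $a\in\mathfrak{a}$ belongs to $\mathcal{L}(\sigma)$. The theory $\sigma$ is of finite type if every ideal in $\mathcal{L}(\sigma)$ contains a finitely generated ideal belonging to $\mathcal{L}(\sigma)$. A module $M$ is totally $\sigma$-torsion if there exists $\mathfrak{h}\in\mathcal{L}(\sigma)$ with $M\mathfrak{h}=0$. An ideal $\mathfrak{a}\subseteq A$ is totally $\sigma$-finitely generated if there is a finitely generated ideal $\mathfrak{a}'\subseteq\mathfrak{a}$ such that $\mathfrak{a}/\mathfrak{a}'$ is totally $\sigma$-torsion (i.e. $\mathfrak{a}\mathfrak{h}\subseteq\mathfrak{a}'$ for some $\mathfrak{h}\in\mathcal{L}(\sigma)$). The ring $A$ is totally $\sigma$-noetherian if every ideal of $A$ is totally $\sigma$-finitely generated. A module is $\sigma$-torsionfree if it has no nonzero element whose annihilator lies in $\mathcal{L}(\sigma)$. $\mathcal{K}(\sigma)$ is the set of prime ideals $\mathfrak{p}$ of $A$ such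 that $A/\mathfrak{p}$ is $\sigma$-torsionfree (equivalently, $\mathfrak{p}\notin\mathcal{L}(\sigma)$). *)

(* Defs.v *)
From mathcomp Require Import all_boot all_algebra.
From mathcomp Require Import boolp classical_sets cardinality.

Set Implicit Arguments.
Unset Strict Implicit.
Unset Printing Implicit Defensive.

Import GRing.Theory.
Local Open Scope classical_set_scope.
Local Open Scope ring_scope.

(* The ideals of ring_quotient are not used: they are decidable and required
   to be proper, while Gabriel filters contain the unit ideal. The type
   comPzRingType includes the zero ring. *)
Record is_ideal (A : comPzRingType) (I : set A) : Prop := IsIdeal {
  ideal0 : I 0;
  idealD : forall x y, I x -> I y -> I (x + y);
  idealM : forall r x, I x -> I (r * x) }.

Definition colon (A : comPzRingType) (b : set A) (a : A) : set A :=
  [set x | b (x * a)].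

Definition fin_gen_ideal (A : comPzRingType) (I : set A) : Prop :=
  exists2 S : set A, finite_set S & I = smallest (@is_ideal A) S.

Record is_prime_ideal (A : comPzRingType) (p : set A) : Prop := IsPrimeIdeal {
  prime_is_ideal : is_ideal p;
  prime_proper : ~ p 1;
  prime_mul : forall x y, p (x * y) -> p x \/ p y }.

(* The improper filter of all ideals is allowed. *)
Record gabriel_filter (A : comPzRingType) (L : set (set A)) : Prop :=
  GabrielFilter {
    gabriel_ideal : forall a, L a -> is_ideal a;
    gabriel_nonempty : L !=set0;
    gabriel_up : forall a b, L a -> is_ideal b -> a `<=` b -> L b;
    gabriel_cap : forall a b, L a -> L b -> L (a `&` b);
    gabriel_colon : forall b, is_ideal b ->
      (exists2 a, L a & forall x, a x -> L (colon b x)) -> L b }.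

Record torsion_theory (A : comPzRingType) := TorsionTheory {
  gabriel : set (set A);
  gabrielP : gabriel_filter gabriel }.

Section Torsion.
Variables (A : comPzRingType) (sigma : torsion_theory A).

Definition finite_type : Prop :=
  forall a, gabriel sigma a ->
  exists b, [/\ gabriel sigma b, fin_gen_ideal b & b `<=` a].

Definition annihilator (M : lmodType A) (m : M) : set A :=
  [set r | r *: m = 0].

Definition totally_torsion (M : lmodType A) : Prop :=
  exists2 h, gabriel sigma h & forall (m : M) r, h r -> r *: m = 0.

Definition torsionfree (M : lmodType A) : Prop :=
  forall m : M, gabriel sigma (annihilator m) -> m = 0.

(* [totally_torsion] for the module N / K, and [torsionfree] for the module
   A / p, written on representatives: see [totally_torsion_quotE] and
   [torsionfree_quotE]. The annihilator of the class of x in A / p is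
   colon p x. *)
Definition totally_torsion_quot (N K : set A) : Prop :=
  exists2 h, gabriel sigma h & forall x r, N x -> h r -> K (x * r).

Definition torsionfree_quot (p : set A) : Prop :=
  forall x, gabriel sigma (colon p x) -> p x.

(* The module N / K is any M presented as follows: N is the image of V in A,
   and M is the quotient of V by the preimage of K. *)
Lemma totally_torsion_quotE (N K : set A) (V M : lmodType A)
    (iota : {linear V -> A^o}) (pi : {linear V -> M}) :
  range iota = N -> range pi = setT -> (forall v, pi v = 0 <-> K (iota v)) ->
  totally_torsion M <-> totally_torsion_quot N K.
Proof.
move=> rN rM kerE; split=> -[h Lh hh]; exists h => //.
- move=> x r; rewrite -rN => -[v _ <-] hr.
  have : pi (r *: v) = 0 by rewrite linearZ; exact: hh.
  by move=> /kerE; rewrite linearZ /= mulrC.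
- move=> m r hr; have : range pi m by rewrite rM.
  move=> [v _ <-]; rewrite -linearZ; apply/kerE.
  rewrite linearZ /= -[X in K X]/(r * iota v) mulrC; apply: hh => //.
  by rewrite -rN; exists v.
Qed.

Lemma torsionfree_quotE (p : set A) (M : lmodType A)
    (pi : {linear A^o -> M}) :
  range pi = setT -> (forall x, pi x = 0 <-> p x) ->
  torsionfree M <-> torsionfree_quot p.
Proof.
move=> rM kerE.
have annE x : annihilator (pi x) = colon p x.
  by apply/seteqP; split=> r /=; rewrite /annihilator /colon /= -linearZ kerE.
split=> tf x.
- by rewrite -annE => /tf /kerE.
- have : range pi x by rewrite rM.
  by move=> [v _ <-]; rewrite annE => /tf /kerE.
Qed.

Definition totally_fin_gen (a : set A) : Prop :=
  exists a' : set A,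
    [/\ fin_gen_ideal a', a' `<=` a & totally_torsion_quot a a'].

Definition totally_noetherian : Prop :=
  forall a : set A, is_ideal a -> totally_fin_gen a.

Definition calK : set (set A) :=
  [set p | is_prime_ideal p /\ torsionfree_quot p].

End Torsion.

(* Main.v *)
Require Import Defs.
From mathcomp Require Import all_boot all_algebra.
From mathcomp Require Import boolp classical_sets cardinality.
From mathcomp Require Import ring.

(** Cohen's argument. An ideal maximal among those that are not totally
    sigma-finitely generated is prime, and since sigma is of finite type it is
    not in the Gabriel filter, so it belongs to K(sigma). For primality, if
    [x * y] is in [p] but neither factor is, then [p + (x)] and [(p : x)] are
    strictly larger than [p], and generators of [p] up to torsion are obtained
    from the [p]-components of generators of the former, together with [x]
    times generators of the latter. *)

Set Implicit Arguments.
Unset Strict Implicit.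
Unset Printing Implicit Defensive.

Import GRing.Theory.
Local Open Scope classical_set_scope.
Local Open Scope ring_scope.

Section Ideals.
Variable A : comPzRingType.
Implicit Types (I J K N S p : set A) (x y : A).

Lemma ideal_colon I x : is_ideal I -> is_ideal (colon I x).
Proof.
move=> [I0 ID IM]; split; rewrite /colon /= ?mul0r //.
- by move=> y z; rewrite mulrDl; exact: ID.
- by move=> r y; rewrite -mulrA; exact: IM.
Qed.

Lemma sub_colon I x : is_ideal I -> I `<=` colon I x.
Proof. by move=> idI y Iy; rewrite /colon /= mulrC; exact: idealM. Qed.

(** This is the ideal quotient [(K : N)]. By upward closure, [N / K] is totally torsion exactly when
    it lies in the Gabriel filter. *)
Lemma ideal_transporter K N :
  is_ideal K -> is_ideal [set r | forall y, N y -> K (y * r)].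
Proof.
move=> [K0 KD KM]; split => /=.
- by move=> y _; rewrite mulr0.
- by move=> r s hr hs y Ny; rewrite mulrDr; apply: KD; [exact: hr|exact: hs].
- by move=> r s hs y Ny; rewrite mulrCA; apply: KM; exact: hs.
Qed.

(** Explicit sums rather than a generated ideal, so that the [I]-component of an element can be
    extracted. *)
Definition add_principal I x : set A :=
  [set z | exists2 y, I y & exists r, z = y + r * x].

Lemma ideal_add_principal I x : is_ideal I -> is_ideal (add_principal I x).
Proof.
move=> [I0 ID IM]; split.
- by exists 0 => //; exists 0; rewrite mul0r addr0.
- move=> _ _ [y Iy [r ->]] [z Iz [s ->]].
  by exists (y + z); [exact: ID|exists (r + s); ring].
- move=> t _ [y Iy [r ->]].
  by exists (t * y); [exact: IM|exists (t * r); ring].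
Qed.

Lemma sub_add_principal I x : I `<=` add_principal I x.
Proof. by move=> y Iy; exists y => //; exists 0; rewrite mul0r addr0. Qed.

Lemma add_principal_mem I x : is_ideal I -> add_principal I x x.
Proof. by move=> idI; exists 0; [exact: ideal0|exists 1; rewrite mul1r add0r]. Qed.

Lemma ideal_smallest S : is_ideal (smallest (@is_ideal A) S).
Proof.
split.
- by move=> I [[]].
- move=> x y Sx Sy I [idI SI].
  by apply: idealD => //; [exact: Sx|exact: Sy].
- by move=> r x Sx I [idI SI]; apply: idealM => //; exact: Sx.
Qed.

Lemma fin_gen_ideal_ideal I : fin_gen_ideal I -> is_ideal I.
Proof. by move=> [S _ ->]; exact: ideal_smallest. Qed.

Lemma fin_gen_ideal_setT : fin_gen_ideal [set: A].
Proof.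
exists [set 1]; first exact: finite_set1.
apply/seteqP; split=> // x _.
by rewrite -[x]mulr1; apply: (idealM (ideal_smallest _)); exact: sub_gen_smallest.
Qed.

Lemma finite_sub_bigcup_chain (T : choiceType) (F : set (set T)) (S : set T) :
  total_on F subset -> F !=set0 -> finite_set S ->
  S `<=` \bigcup_(X in F) X -> exists2 X, F X & S `<=` X.
Proof.
move=> Ftot [X0 FX0] /finite_seqP[s ->].
elim: s => [|a s IHs] sF; first by exists X0.
have [|X FX sX] := IHs; first by move=> b bs; apply: sF; rewrite /= inE bs orbT.
have [|Y FY Ya] := sF a; first by rewrite /= mem_head.
have [XY|YX] := Ftot _ _ FX FY.
- by exists Y => // b; rewrite /= inE => /predU1P[->//|/sX/XY].
- by exists X => // b; rewrite /= inE => /predU1P[->|/sX//]; exact: YX.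
Qed.

End Ideals.

Section Cohen.
Variables (A : comPzRingType) (sigma : torsion_theory A).
Implicit Types (I K N p : set A) (x : A).

Lemma gabriel_sub I K :
  gabriel sigma I -> is_ideal K -> I `<=` K -> gabriel sigma K.
Proof. exact: (gabriel_up (gabrielP sigma)). Qed.

(* The transporter of N into K is in L(sigma) by the colon axiom, so products
   of ideals of L(sigma) are not needed. *)
Lemma totally_torsion_quot_mul N K I J :
    is_ideal K -> gabriel sigma I -> gabriel sigma J ->
  (forall x r s, N x -> I r -> J s -> K (x * r * s)) ->
  totally_torsion_quot sigma N K.
Proof.
move=> idK LI LJ NIJ; have idT := ideal_transporter N idK.
exists [set r | forall y, N y -> K (y * r)]; last by move=> x r Nx; exact.
apply: (gabriel_colon (gabrielP sigma)) => //; exists I => // r Ir.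
apply: (gabriel_sub LJ); first exact: ideal_colon.
by move=> s Js y Ny; rewrite [s * r]mulrC mulrA; exact: NIJ.
Qed.

Lemma totally_fin_gen_fin_gen I : fin_gen_ideal I -> totally_fin_gen sigma I.
Proof.
move=> fgI; have idI := fin_gen_ideal_ideal fgI.
exists I; split => //; have [h Lh] := gabriel_nonempty (gabrielP sigma).
by exists h => // x r Ix _; rewrite mulrC; exact: idealM.
Qed.

(** A finitely generated [b] in the filter with [b] inside [I] plays both roles: it is the subideal,
    and it kills [I / b] because [I * b] lies in [b]. *)
Lemma totally_fin_gen_gabriel I :
  finite_type sigma -> gabriel sigma I -> totally_fin_gen sigma I.
Proof.
move=> sigma_fin /sigma_fin[b [Lb fgb bI]]; exists b; split => //.
by exists b => // x r _ br; apply: idealM => //; exact: fin_gen_ideal_ideal.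
Qed.

(** The finitely many generators already lie in one member of the chain, and the [h] that works for
    the union works for that member. *)
Lemma totally_fin_gen_bigcup_chain (F : set (set A)) :
    total_on F subset -> F !=set0 -> (forall I, F I -> is_ideal I) ->
    totally_fin_gen sigma (\bigcup_(I in F) I) ->
  exists2 I, F I & totally_fin_gen sigma I.
Proof.
move=> Ftot F0 Fid [a [[S finS ->] aF [h Lh hF]]].
have [I FI SI] : exists2 I, F I & S `<=` I.
  apply: finite_sub_bigcup_chain => //.
  exact: subset_trans (@sub_gen_smallest _ _ _) aF.
exists I => //; exists (smallest (@is_ideal A) S); split; first by exists S.
- by apply: smallest_sub => //; exact: Fid.
- by exists h => // x r Ix; apply: hF; exists I.
Qed.

Lemma totally_fin_gen_add_colon p x : is_ideal p ->
    totally_fin_gen sigma (add_principal p x) ->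
    totally_fin_gen sigma (colon p x) ->
  totally_fin_gen sigma p.
Proof.
move=> idp [_ [[S finS ->] Sp [h Lh hS]]] [_ [[T finT ->] Tp [h' Lh' hT]]].
(* [f s] is a [p]-component of the generator [s]; outside [S] the value 0 is a dummy. *)
have /choice[f fP] s : exists y, S s -> p y /\ exists r, s = y + r * x.
  have [/(@sub_gen_smallest _ (@is_ideal A))/Sp[y py rP]|nSs] := pselect (S s).
    by exists y.
  by exists 0.
pose G := f @` S `|` (fun t => t * x) @` T.
pose K := smallest (@is_ideal A) G.
have idK : is_ideal K by exact: ideal_smallest.
have GK : G `<=` K by exact: sub_gen_smallest.
have Kp : K `<=` p.
  apply: smallest_sub => // _ [[s Ss <-]|[t Tt <-]]; first by case: (fP s Ss).
  by apply: Tp; exact: sub_gen_smallest.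
exists K; split => //.
  by exists G => //; rewrite finite_setU; split; exact: finite_image.
(* Write [y * r = k + c * x] with [k] in [K]. Then [c * x = y * r - k] is in [p], so [c] is in
   [(p : x)], and multiplying by [s] moves [c * s] into the ideal generated by [T], whence
   [c * s * x] is in [K]. *)
apply: (totally_torsion_quot_mul idK Lh Lh') => y r s py hr hs.
have [k Kk [c yrE]] : add_principal K x (y * r).
  move: (hS _ _ (sub_add_principal x py) hr).
  apply: smallest_sub; first exact: ideal_add_principal.
  by move=> t St; exists (f t); [apply: GK; left; exists t|case: (fP t St)].
have pc : colon p x c.
  rewrite /colon /= (_ : c * x = r * y + -1 * k).
    by apply: idealD => //; apply: idealM => //; exact: Kp.
  by rewrite [r * y]mulrC yrE; ring.
have Kcs : colon K x (c * s).
  move: (hT _ _ pc hs); apply: smallest_sub; first exact: ideal_colon.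
  by move=> t Tt; apply: GK; right; exists t.
rewrite yrE (_ : _ * s = s * k + c * s * x); last by ring.
by apply: (idealD idK) => //; exact: (idealM idK).
Qed.

Lemma maximal_not_totally_fin_gen_prime p :
    is_ideal p -> ~ totally_fin_gen sigma p ->
    (forall I, is_ideal I -> p `<` I -> totally_fin_gen sigma I) ->
  is_prime_ideal p.
Proof.
move=> idp np pmax; split=> //.
- move=> p1; apply: np; rewrite (_ : p = setT).
    exact/totally_fin_gen_fin_gen/fin_gen_ideal_setT.
  by apply/seteqP; split=> // x _; rewrite -[x]mulr1; exact: idealM.
- move=> x y pxy; apply: contrapT => /not_orP[npx npy]; apply: np.
  (* Both inclusions are strict: [x] is in [p + (x)] and [y] is in [(p : x)], but neither is in
     [p]. *)
  apply: (totally_fin_gen_add_colon (x := x)) => //; apply: pmax.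
  + exact: ideal_add_principal.
  + split; first exact: sub_add_principal.
    by move=> /(_ x (add_principal_mem x idp)).
  + exact: (ideal_colon x idp).
  + split; first exact: sub_colon.
    by move=> /(_ y); rewrite /colon /= mulrC => /(_ pxy).
Qed.

(** For [x] outside [p], primality puts [(p : x)] inside [p], so [(p : x)] in the filter would force
    [p] into it. *)
Lemma prime_torsionfree_quot p :
  is_prime_ideal p -> ~ gabriel sigma p -> torsionfree_quot sigma p.
Proof.
move=> [idp _ pM] npL x Lpx; apply: contrapT => npx; apply: npL.
by apply: (gabriel_sub Lpx) => // y /pM[].
Qed.

Lemma exists_maximal_not_totally_fin_gen I :
    is_ideal I -> ~ totally_fin_gen sigma I ->
  exists p, [/\ is_ideal p, ~ totally_fin_gen sigma p &
    forall J, is_ideal J -> p `<` J -> totally_fin_gen sigma J].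
Proof.
move=> idI nI; pose bad J := is_ideal J /\ ~ totally_fin_gen sigma J.
(* [set0] is added because it is the union of the empty chain. *)
have [F Fbad Ftot|p [badp pmax]] :=
    @Zorn_bigcup A [set J | J = set0 \/ bad J].
  (* Dropping the empty set from the chain leaves its union unchanged and makes every member an
     ideal. *)
  pose G := F `&` bad.
  have FG : \bigcup_(J in F) J = \bigcup_(J in G) J.
    apply/seteqP; split=> x [J]; last by case=> FJ _ Jx; exists J.
    by move=> FJ Jx; case: (Fbad _ FJ) Jx => [->//|bJ Jx]; exists J.
  have Gtot : total_on G subset by move=> J K [FJ _] [FK _]; exact: Ftot.
  have Gid J : G J -> is_ideal J by case=> _ [].
  rewrite FG /=; have [->|/set0P G0] := eqVneq G set0.
    by left; rewrite bigcup_set0.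
  right; split; last first.
    by move=> /(totally_fin_gen_bigcup_chain Gtot G0 Gid)[J [_ []]].
  split.
  - by case: G0 => J GJ; exists J => //; exact: ideal0 (Gid _ GJ).
  - move=> x y [J GJ Jx] [K GK Ky]; have [JK|KJ] := Gtot _ _ GJ GK.
      by exists K => //; apply: (idealD (Gid _ GK)) => //; exact: JK.
    by exists J => //; apply: (idealD (Gid _ GJ)) => //; exact: KJ.
  - by move=> r x [J GJ Jx]; exists J => //; exact: idealM (Gid _ GJ) _ _ Jx.
(* The maximal element is not [set0], since the bad ideal [I] contains 0 and would be strictly
   larger. *)
have [p0|[idp np]] := badp.
  case: (pmax I); last by right.
  by rewrite p0; split=> // /(_ _ (ideal0 idI)).
exists p; split=> // J idJ pJ; apply: contrapT => nJ.
by apply: (pmax _ pJ); right.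
Qed.

End Cohen.

Theorem corollary5 (A : comPzRingType) (sigma : torsion_theory A)
    (sigma_fin : finite_type sigma) :
  totally_noetherian sigma <->
  (forall p : set A, calK sigma p -> totally_fin_gen sigma p).
Proof.
split=> [noeth p [[idp _ _] _]|Kfg I idI]; first exact: noeth.
apply: contrapT => nI.
have [p [idp np pmax]] := exists_maximal_not_totally_fin_gen idI nI.
have prp := maximal_not_totally_fin_gen_prime idp np pmax.
apply/np/Kfg; split=> //; apply: prime_torsionfree_quot => // Lp.
exact/np/totally_fin_gen_gabriel.
Qed.
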